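(* Let $r$ be a positive integer or $r=\infty$. The fermionic Fock space $F^r_0$ has a canonical structure of free $B_r$-module of rank $1$ generated by the vacuum vector $\Phi^r_0=u_0\wedge u_{-1}\wedge u_{-2}\wedge\cdots$. Explicitly: the $\mathbb{Q}$-linear map $F^r_0\to B_r$, $\alpha\mapsto[\alpha]$ (defined in the context) is bijective and sends $\Phi^r_0$ to $1$, so that transporting the $B_r$-module structure of $B_r$ along it makes $F^r_0$ a free $B_r$-module of rank $1$ generated by $\Phi^r_0$. Moreover, for this structure, for every $\boldsymbol{\lambda}\in\mathcal{P}_r$, $$\Phi^r_{0,\boldsymbol{\lambda}}=\Delta_{\boldsymbol{\lambda}}(H_r)\,\Phi^r_0 .$$
   Context: Let $r\in\{1,2,3,\dots\}\cup\{\infty\}$. $B_r=\mathbb{Q}[e_i : i\in\mathbb{N},\ 1\le i\le r]$ is a polynomial ring; $e_0=1$ and $e_i=0$ for $i>r$. $E_r(t)=1+\sum_{1\le i\le r}(-1)^ie_it^i\in B_r[[t]]$, and $H_r=(h_n)_{n\in\mathbb{Z}}$ is defined by $\sum_{n\in\mathbb{Z}}h_nt^n=1/E_r(t)$ in $B_r[[t]]$ (so $h_n=0$ for $n<0$, $h_0=1$). $\mathcal{P}_r$ is the set of partitions $\boldsymbol{\lambda}=(\lambda_1\ge\lambda_2\ge\cdots)$ with at most $r$ nonzero parts (all partitions if $r=\infty$). $\Delta_{\boldsymbol{\lambda}}(H_r)=\det(h_{\lambda_j-j+i})_{1\le i,j\le k}$, where $k=r$ if $r<\infty$ and $k$ is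 any integer at least the length of $\boldsymbol{\lambda}$ if $r=\infty$ (the value does not depend on $k$). For $j\in\mathbb{Z}$ let $u_j=\sum_{n\ge0}h_{n+j}\frac{t^n}{n!}\in B_r[[t]]$; the $u_j$ are linearly independent over $\mathbb{Q}$ and $V_r=\bigoplus_{j\in\mathbb{Z}}\mathbb{Q}u_j$. Semi-infinite exterior monomials $u_{i_0}\wedge u_{i_1}\wedge u_{i_2}\wedge\cdots$ (with $i_{m+1}=i_m-1$ for all large $m$) are formal symbols, alternating in their entries; those with strictly decreasing indices are linearly independent over $\mathbb{Q}$. Put $\Phi^r_{0,\boldsymbol{\lambda}}=u_{\lambda_1}\wedge u_{-1+\lambda_2}\wedge u_{-2+\lambda_3}\wedge\cdots$ (with $\lambda_m=0$ beyond the length of $\boldsymbol{\lambda}$), $\Phi^r_0=\Phi^r_{0,(0)}$, and $F^r_0=\bigoplus_{\boldsymbol{\lambda}\in\mathcal{P}_r}\mathbb{Q}\,\Phi^r_{0,\boldsymbol{\lambda}}$. For $\phi=\sum_{n\ge0}a_n\frac{t^n}{n!}\in B_r[[t]]$ and $k\in\mathbb{N}$ let $U_k(\phi)=a_k+\sum_{i\ge1}(-1)^ie_ia_{k-i}$, where $a_j=0$ for $j<0$. One has $\phi=\sum_{i\ge0}U_i(\phi)u_{-i}$. For a semi-infinite monomial $\alpha=u_{i_0}\wedge u_{i_1}\wedge\cdots$ with $i_m=-m$ for all $m\ge k$, the quotient $[\alpha]=(\alpha\otimes_{\mathbb{Q}}1_{B_r})/\Phi^r_0$ is obtained by expanding each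 $u_{i_b}$ $B_r$-linearly in the $u_{-a}$, $a\geq 0$: $[\alpha]=\det\big(U_a(u_{i_b})\big)_{0\le a,b\le k-1}\in B_r$ (independent of the choice of $k$). Extend $[\cdot]$ $\mathbb{Q}$-linearly. *)

(* Defs.v *)
From HB Require Import structures.
From mathcomp Require Import all_boot all_order all_algebra.
From mathcomp Require Import finmap.
From mathcomp.multinomials Require Import monalg.
From mathcomp Require Import boolp.
From mathcomp Require Import zify.

Set Implicit Arguments.
Unset Strict Implicit.
Unset Printing Implicit Defensive.

Import Order.TTheory GRing.Theory Num.Theory.
Local Open Scope ring_scope.

(* The parameter r in {1, 2, ...} U {oo} is an [option nat], [None] being oo. *)
Definition le_rank (i : nat) (r : option nat) : bool :=
  if r is Some n then (i <= n)%N else true.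

Section PowerSeries.
Variable R : comNzRingType.

(* R[[t]] is represented by [nat -> R], n |-> coefficient of t^n. *)
Definition fps_mul (f g : nat -> R) (n : nat) : R :=
  \sum_(i < n.+1) f i * g (n - i)%N.

(* 1/f for f with constant term 1: the n-th coefficient of the inverse g is
   [n = 0] - \sum_(i < n) f_(n-i) g_i; [fps_inv_seq f n] is the list of the
   first n of them. *)
Fixpoint fps_inv_seq (f : nat -> R) (n : nat) : seq R :=
  if n is n'.+1 then
    let s := fps_inv_seq f n' in
    rcons s ((n' == 0%N)%:R - \sum_(i < n') f (n' - i)%N * s`_i)
  else [::].

Definition fps_inv (f : nat -> R) (n : nat) : R := (fps_inv_seq f n.+1)`_n.

Lemma size_fps_inv_seq f n : size (fps_inv_seq f n) = n.
Proof. by elim: n => //= n IH; rewrite size_rcons IH. Qed.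

Lemma nth_fps_inv_seq f n i : (i < n)%N -> (fps_inv_seq f n)`_i = fps_inv f i.
Proof.
elim: n => // n IH; rewrite ltnS leq_eqVlt => /orP[/eqP->//|lt_in] /=.
by rewrite nth_rcons size_fps_inv_seq lt_in IH.
Qed.

Lemma fps_invE f n :
  fps_inv f n = (n == 0%N)%:R - \sum_(i < n) f (n - i)%N * fps_inv f i.
Proof.
rewrite {1}/fps_inv /= nth_rcons size_fps_inv_seq ltnn eqxx.
by congr (_ - _); apply: eq_bigr => i _; rewrite nth_fps_inv_seq.
Qed.

Lemma fps_mulfV f n : f 0%N = 1 -> fps_mul f (fps_inv f) n = (n == 0%N)%:R.
Proof.
move=> f0; rewrite /fps_mul (reindex_inj rev_ord_inj) /= big_ord_recr /=.
rewrite subnn f0 mul1r subn0 [in X in _ + X]fps_invE addrC.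
rewrite -addrA -[RHS]addr0; congr (_ + _).
apply/eqP; rewrite addrC subr_eq0; apply/eqP; apply: eq_bigr => i _.
by rewrite subSS subKn // ltnW.
Qed.

End PowerSeries.

Section FermionicFock.
Variable r : option nat.

Definition varidx := {i : nat | (0 < i)%N && le_rank i r}.

(* B_r: [{cmonom I}] is the free commutative monoid on I, so its monoid algebra
   is the polynomial ring in the indeterminates indexed by I, I possibly
   infinite. *)
Definition Bring := {malg rat[{cmonom varidx}]}.
HB.instance Definition _ := GRing.ComAlgebra.on Bring.

Definition e_ (i : nat) : Bring :=
  if i is 0%N then 1 else
  if insub i is Some x then << (ucm (x : varidx)) >> else 0.

Definition Eser (n : nat) : Bring := (-1) ^+ n * e_ n.

Definition h_ (n : int) : Bring := if n is Posz m then fps_inv Eser m else 0.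

Definition u_ (j : int) (n : nat) : Bring :=
  (n`!%:R^-1 : rat) *: h_ (n%:Z + j).

(* phi = \sum_n (egf_coef phi n) t^n / n! *)
Definition egf_coef (phi : nat -> Bring) (n : nat) : Bring :=
  (n`!%:R : rat) *: phi n.

Definition U_ (k : nat) (phi : nat -> Bring) : Bring :=
  egf_coef phi k
  + \sum_(1 <= i < k.+1) (-1) ^+ i * e_ i * egf_coef phi (k - i)%N.

(* Partitions with at most r nonzero parts, as the nonincreasing list of their
   nonzero parts; the part lambda_m (m >= 1) is [part_nth la m.-1]. *)
Definition is_part (la : seq nat) : bool :=
  [&& sorted geq la, 0%N \notin la & le_rank (size la) r].

Definition partr := {la : seq nat | is_part la}.

Definition part_nth (la : partr) (m : nat) : nat := nth 0%N (val la) m.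

Lemma is_part_nil : is_part [::].
Proof. by rewrite /is_part; case: r. Qed.

Definition part0 : partr := exist _ [::] is_part_nil.

Definition Delta (k : nat) (la : partr) : Bring :=
  \det (\matrix_(i < k, j < k) h_ ((part_nth la j)%:Z - j%:Z + i%:Z)).

(* Semi-infinite monomials u_(i_0) /\ u_(i_1) /\ ... of charge 0 (i_m = -m for m
   large) in normal form, i.e. with strictly decreasing indices. *)
Record simono := Simono {
  simono_idx :> nat -> int;
  simono_decr : forall m, simono_idx m.+1 < simono_idx m;
  simono_tail : exists k, forall m, (k <= m)%N -> simono_idx m = - m%:Z }.

HB.instance Definition _ := gen_eqMixin simono.
HB.instance Definition _ := gen_choiceMixin simono.

Definition part_idx (la : partr) (m : nat) : int := (part_nth la m)%:Z - m%:Z.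

Lemma part_idx_decr la m : part_idx la m.+1 < part_idx la m.
Proof.
suff le_la : (part_nth la m.+1 <= part_nth la m)%N.
  by rewrite /part_idx; lia.
rewrite /part_nth; case: la => la /= /and3P[la_sorted _ _].
have [le_sz|lt_sz] := leqP (size la) m.+1; first by rewrite nth_default.
have geq_trans : transitive geq by move=> a b c /= ? /leq_trans; apply.
by apply: (sorted_ltn_nth geq_trans 0%N la_sorted); rewrite ?inE // ltnW.
Qed.

Lemma part_idx_tail la :
  exists k, forall m, (k <= m)%N -> part_idx la m = - m%:Z.
Proof.
by exists (size (val la)) => m le_m; rewrite /part_idx /part_nth nth_default // sub0r.
Qed.

Definition part_mono (la : partr) : simono :=
  Simono (part_idx_decr la) (part_idx_tail la).

Definition fock_pred : {pred {malg rat[simono]}} :=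
  [pred v : {malg rat[simono]} |
    all (fun m => `[< exists la, m = part_mono la >]) (msupp v)].

Lemma fock_predP (v : {malg rat[simono]}) :
  reflect (forall m, v@_m != 0 -> exists la, m = part_mono la)
          (v \in fock_pred).
Proof.
apply: (iffP allP) => [H m|H m].
  by rewrite mcoeff_neq0 => /H /asboolP.
by rewrite -mcoeff_neq0 => /H H'; apply/asboolP.
Qed.

Lemma fock_submod : GRing.submod_closed fock_pred.
Proof.
split=> [|c v w /fock_predP Hv /fock_predP Hw]; apply/fock_predP => m.
  by rewrite mcoeff0 eqxx.
rewrite mcoeffD mcoeffZ; have [v0|/Hv//] := eqVneq v@_m 0.
by rewrite v0 mulr0 add0r => /Hw.
Qed.

HB.instance Definition _ := GRing.isSubmodClosed.Build rat {malg rat[simono]}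
  fock_pred fock_submod.

(* F^r_0, the Q-span of the monomials [part_mono la], la in P_r. *)
Record Fock := MkFock {
  fock_val :> {malg rat[simono]};
  fock_valP : fock_val \in fock_pred }.

HB.instance Definition _ := [isSub for fock_val].
HB.instance Definition _ := [Choice of Fock by <:].
HB.instance Definition _ := [SubChoice_isSubLmodule of Fock by <:].

Lemma part_mono_fock la : << part_mono la >> \in fock_pred.
Proof.
apply/fock_predP => m; rewrite mcoeffU.
by have [<- _|_] := eqVneq (part_mono la) m; [exists la | rewrite mulr0n eqxx].
Qed.

Definition Phi (la : partr) : Fock := MkFock (part_mono_fock la).

Definition Phi0 : Fock := Phi part0.

Definition bracket_det (i : nat -> int) (k : nat) : Bring :=
  \det (\matrix_(a < k, b < k) U_ a (u_ (i b))).

(* Here k is any integer as in [simono_tail]; see [bracket_monoE]. *)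
Definition bracket_mono (m : simono) : Bring :=
  bracket_det m (projT1 (cid (simono_tail m))).

Definition bracket (v : Fock) : Bring :=
  \sum_(m <- msupp (val v)) (val v)@_m *: bracket_mono m.

Lemma bracketEw (v : Fock) (d : {fset simono}) : (msupp (val v) `<=` d)%fset ->
  bracket v = \sum_(m <- d) (val v)@_m *: bracket_mono m.
Proof.
move=> le_d; rewrite /bracket; apply: big_fset_incl => // m _ /mcoeff_outdom ->.
by rewrite scale0r.
Qed.

Lemma bracket_is_linear : linear bracket.
Proof.
move=> c v w; pose x : Fock := c *: v + w; pose d : {fset simono} := (msupp (val v) `|` msupp (val w)
  `|` msupp (val x))%fset.
rewrite !(@bracketEw _ d); first last.
- exact: fsubsetUr.
- exact: fsubset_trans (fsubsetUl _ _) (fsubsetUl _ _).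
- exact: fsubset_trans (fsubsetUr _ _) (fsubsetUl _ _).
rewrite scaler_sumr -big_split /=; apply: eq_bigr => m _.
by rewrite mcoeffD mcoeffZ scalerDl scalerA.
Qed.

HB.instance Definition _ :=
  GRing.isLinear.Build rat Fock Bring _ bracket bracket_is_linear.

Lemma U_E k phi :
  U_ k phi = \sum_(i < k.+1) Eser i * egf_coef phi (k - i)%N.
Proof.
have E0 : Eser 0 = 1 by rewrite /Eser expr0 mul1r.
by rewrite /U_ big_add1 /= big_mkord big_ord_recl E0 mul1r subn0.
Qed.

Lemma U_u_neg a b : U_ a (u_ (- b%:Z)) = (a == b)%:R.
Proof.
have cE j n : egf_coef (u_ j) n = h_ (n%:Z + j).
  rewrite /egf_coef /u_ scalerA mulfV ?scale1r //.
  by rewrite pnatr_eq0 -lt0n fact_gt0.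
have UE : U_ a (u_ (- b%:Z)) =
    \sum_(i < a.+1) Eser i * h_ ((a - i)%N%:Z - b%:Z).
  by rewrite U_E; apply: eq_bigr => i _; rewrite cE.
have h_neg (n : int) : n < 0 -> h_ n = 0 by case: n.
rewrite UE; have [lt_ab|le_ba] := ltnP a b.
  rewrite (ltn_eqF lt_ab) big1 // => i _.
  by rewrite h_neg ?mulr0 //; lia.
have -> : (a == b) = (a - b == 0)%N by lia.
rewrite -(@fps_mulfV _ Eser) /fps_mul; last by rewrite /Eser mulr1.
have le_n : ((a - b).+1 <= a.+1)%N by rewrite ltnS leq_subr.
rewrite (big_ord_widen _ (fun i => Eser i * fps_inv Eser (a - b - i)) le_n).
rewrite [RHS]big_mkcond; apply: eq_bigr => i _.
have lt_i := ltn_ord i; case: ifPn => [le_i|gt_i].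
  have -> : (a - i)%N%:Z - b%:Z = (a - b - i)%N%:Z by lia.
  by [].
by rewrite h_neg ?mulr0 //; lia.
Qed.

Lemma bracket_detS (i : nat -> int) (k : nat) : i k = - k%:Z ->
  bracket_det i k.+1 = bracket_det i k.
Proof.
move=> ik; rewrite /bracket_det (expand_det_col _ ord_max) big_ord_recr /=.
rewrite big1 => [|a _]; last first.
  by rewrite mxE ik U_u_neg /= (ltn_eqF (ltn_ord a)) mul0r.
rewrite mxE ik U_u_neg eqxx mul1r add0r /cofactor /= -signr_odd oddD addbb mul1r.
congr (\det _); apply/matrixP => a b; rewrite !mxE /= /bump.
by rewrite !(leqNgt k) !ltn_ord.
Qed.

Lemma bracket_det_indep (i : nat -> int) (k l : nat) :
  (forall m, (k <= m)%N -> i m = - m%:Z) ->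
  (forall m, (l <= m)%N -> i m = - m%:Z) ->
  bracket_det i k = bracket_det i l.
Proof.
wlog le_kl : k l / (k <= l)%N => [IH Hk Hl|Hk _].
  by have [/IH|/ltnW/IH IHlk] := leqP k l; [apply | rewrite IHlk].
rewrite -(subnKC le_kl); elim: (l - k)%N => [|n IH]; first by rewrite addn0.
by rewrite IH addnS bracket_detS // Hk // leq_addr.
Qed.

Lemma bracket_monoE (m : simono) (k : nat) :
  (forall j, (k <= j)%N -> m j = - j%:Z) -> bracket_mono m = bracket_det m k.
Proof. by apply: bracket_det_indep; case: cid. Qed.

Lemma bracket_Phi (la : partr) : bracket (Phi la) = bracket_mono (part_mono la).
Proof.
rewrite (@bracketEw _ [fset part_mono la]%fset) ?msuppU_le //.
by rewrite big_seq_fset1 mcoeffUU scale1r.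
Qed.

End FermionicFock.

(* The B-module structure on V transported from B along a bijective f : V -> B. *)
Section Transport.
Variables (B : pzRingType) (V : zmodType) (f : {additive V -> B}).
Variable f_bij : bijective f.

Lemma transport_inv_ex : exists g : B -> V, cancel f g /\ cancel g f.
Proof. by case: f_bij => g fK gK; exists g. Qed.

Definition transport_inv : B -> V := projT1 (cid transport_inv_ex).

Lemma transport_invK : cancel transport_inv f.
Proof. by rewrite /transport_inv; case: cid => g []. Qed.

Definition transport_scale (b : B) (v : V) : V := transport_inv (b * f v).

Lemma transport_scaleE b v : f (transport_scale b v) = b * f v.
Proof. exact: transport_invK. Qed.

Lemma transport_scaleA a b v :
  transport_scale a (transport_scale b v) = transport_scale (a * b) v.
Proof. by apply: (bij_inj f_bij); rewrite !transport_scaleE mulrA. Qed.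

Lemma transport_scale1 : left_id 1 transport_scale.
Proof.
by move=> v; apply: (bij_inj f_bij); rewrite transport_scaleE mul1r.
Qed.

Lemma transport_scaleDr : right_distributive transport_scale +%R.
Proof.
move=> a v w; apply: (bij_inj f_bij).
by rewrite raddfD !transport_scaleE raddfD mulrDr.
Qed.

Lemma transport_scaleDl v : {morph transport_scale^~ v : a b / a + b}.
Proof.
move=> a b; apply: (bij_inj f_bij).
by rewrite raddfD !transport_scaleE mulrDl.
Qed.

Definition transported : Type := let _ := f_bij in V.

HB.instance Definition _ := GRing.Zmodule.copy transported V.
HB.instance Definition _ := GRing.Zmodule_isLmodule.Build B transported
  transport_scaleA transport_scale1 transport_scaleDr transport_scaleDl.

End Transport.

(* Main.v *)
Require Import Defs.
From HB Require Import structures.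
From mathcomp Require Import all_boot all_order all_fingroup all_algebra.
From mathcomp.multinomials Require Import monalg.
From mathcomp Require Import finmap boolp zify ring.

Set Implicit Arguments.
Unset Strict Implicit.
Unset Printing Implicit Defensive.

Import Order.TTheory GRing.Theory Num.Theory.
Local Open Scope ring_scope.

(* Column reduction identifies the bracket of Phi_la with the Jacobi-Trudi
   determinant s_la = Delta_la, so the point is that the s_la form a Q-basis of B_r.
   For finite r two facts suffice: s_(la + 1^r) = e_r s_la (the columns move by the
   companion matrix of the recurrence for the h_n, of determinant e_r), and setting
   e_r = 0 sends s_la to s_la if la has fewer than r parts and to 0 otherwise.
   Independence follows by induction on r, and then on the last part: kill e_r, then
   cancel e_r. Spanning follows from B_r = B_(r-1) + e_r B_r by induction on r
   and on the weight (deg e_i = i). For r = oo, each weight n is reached through B_n,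
   since s_la and all elements of weight n involve only e_1, ..., e_n. *)

(** * Commutative monomials: evaluation and cancellation *)

Section Monomials.
Variable I : choiceType.

Lemma cmonom_rect_ucm (P : {cmonom I} -> Prop) :
  P mone -> (forall i m, P m -> P (mmul (ucm i) m)) -> forall m, P m.
Proof.
move=> P1 PM m; move Ed: (mdeg m) => d; elim: d m Ed => [|d IH] m Ed.
  by rewrite (mdeg_eq0I Ed).
have [i mi]: exists i, m i != 0%N.
  apply: contrapT => m0; suff m1 : m = mone by rewrite m1 mdeg1 in Ed.
  apply/eqP/cmP => i; rewrite cm1; apply/eqP; apply: contraT => mi.
  by case: m0; exists i.
have defm : m = mmul (ucm i) (divcm m (ucm i)).
  apply/eqP/cmP => j; rewrite cmM divcmE cmU; case: eqVneq => [<-|_] /=; lia.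
rewrite defm; apply/PM/IH.
by move: Ed; rewrite {1}defm mdegM mdegU => -[].
Qed.

Definition cmonom_eval (A : comNzRingType) (x : I -> A) (m : {cmonom I}) : A :=
  \prod_(i <- finsupp m) x i ^+ m i.

Lemma cmonom_evalEw (A : comNzRingType) (x : I -> A) (m : {cmonom I}) (d : {fset I}) :
  (finsupp m `<=` d)%fset -> cmonom_eval x m = \prod_(i <- d) x i ^+ m i.
Proof.
move=> le_d; rewrite /cmonom_eval (big_fset_incl _ le_d) // => i _.
by rewrite -cmE_neq0 negbK => /eqP->.
Qed.

Lemma cmonom_eval_morph (A : comNzRingType) (x : I -> A) :
  mmorphism (cmonom_eval x).
Proof.
split=> [m n|]; last by rewrite /cmonom_eval mdom1 big_seq_fset0.
rewrite {1}/cmonom_eval mdomD.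
rewrite (cmonom_evalEw _ (fsubsetUl (finsupp m) (finsupp n))).
rewrite (cmonom_evalEw _ (fsubsetUr (finsupp m) (finsupp n))).
by rewrite -big_split /=; apply: eq_bigr => i _; rewrite cmM exprD.
Qed.

HB.instance Definition _ (A : comNzRingType) (x : I -> A) :=
  isMultiplicative.Build {cmonom I} A (cmonom_eval x) (cmonom_eval_morph x).

Lemma cmonom_evalU (A : comNzRingType) (x : I -> A) i :
  cmonom_eval x (ucm i) = x i.
Proof. by rewrite /cmonom_eval mdomU big_seq_fset1 cmUU. Qed.

(** The free commutative monoid is cancellative, so multiplication by [m] moves the coefficient at
    [k] to [mmul m k]. This makes each indeterminate e_i a non-zero-divisor. *)
Lemma mulU_inj (R : nzRingType) (m : {cmonom I}) :
  injective (fun b : {malg R[{cmonom I}]} => << m >> * b).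
Proof.
move=> b c eq_bc; apply/malgP => k.
have coefM (g : {malg R[{cmonom I}]}) : (<< m >> * g)@_(mmul m k) = g@_k.
  rewrite malgM_def fgmulUg raddf_sum /=.
  rewrite [in RHS](monalgE g) raddf_sum /=.
  apply: eq_bigr => j _; rewrite !mcoeffU mul1r; congr (_ *+ nat_of_bool _).
  apply/eqP/eqP => [/eqP/cmP eq_jk|->//]; apply/eqP/cmP => i.
  by have := eq_jk i; rewrite !cmM => /addnI.
by rewrite -(coefM b) -(coefM c) /= eq_bc.
Qed.
End Monomials.

(** * Weights, complete functions and Jacobi-Trudi determinants of an abstract sequence [e] *)

Section Homogeneous.
Variables (K : nzRingType) (A : comNzRingType) (iota : {rmorphism K -> A}).
Variable e : nat -> A.
Hypothesis e0 : e 0%N = 1.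
Implicit Types a b c : A.

(** The elements of weight n, where e_i has weight i and scalars have weight 0, built by multiplying
    by one e_i at a time; this is the induction used below. *)
Inductive homog : nat -> A -> Prop :=
| homog0 n : homog n 0
| homog1 : homog 0 1
| homogX i n b : homog n b -> homog (i + n) (e i * b)
| homogZD n z b c : homog n b -> homog n c -> homog n (iota z * b + c).

Lemma homogD n b c : homog n b -> homog n c -> homog n (b + c).
Proof. by move=> hb hc; rewrite -[b]mul1r -(rmorph1 iota); apply: homogZD. Qed.

Lemma homogN n b : homog n b -> homog n (- b).
Proof.
move=> hb; rewrite -mulN1r -(rmorphN1 iota) -[_ * b]addr0.
exact/homogZD/homog0.
Qed.

Lemma homogM m n b c : homog m b -> homog n c -> homog (m + n) (b * c).
Proof.
move=> hb hc; elim: hb => {m b} [m||i m b _ IH|m z b b' _ IH _ IH'].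
- by rewrite mul0r; apply: homog0.
- by rewrite mul1r.
- by rewrite -mulrA -addnA; apply: homogX.
- by rewrite mulrDl -mulrA; apply: homogZD.
Qed.

Lemma homog_sum n (T : Type) (s : seq T) (P : pred T) (F : T -> A) :
  (forall x, P x -> homog n (F x)) -> homog n (\sum_(x <- s | P x) F x).
Proof. by move=> hF; elim/big_ind: _ => //; [exact: homog0 | exact: homogD]. Qed.

(** Negative weights contain only 0. This agrees with h_n = 0 for n < 0 and lets a quotient by
    e_(p+1) have weight n - (p+1) for every n. *)
Definition homogz (n : int) b : Prop := if n is Posz m then homog m b else b = 0.

Lemma homogz0 n : homogz n 0. Proof. by case: n => //= n; apply: homog0. Qed.

Lemma homogzZD n z b c : homogz n b -> homogz n c -> homogz n (iota z * b + c).
Proof.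
by case: n => [n|n] /=; [apply: homogZD | move=> -> ->; rewrite mulr0 addr0].
Qed.

Lemma homogzM m n b c : homogz m b -> homogz n c -> homogz (m + n) (b * c).
Proof.
case: m n => [m|m] [n|n] hb hc; first exact: homogM.
- by rewrite (hc : c = 0) mulr0; apply: homogz0.
- by rewrite (hb : b = 0) mul0r; apply: homogz0.
- by rewrite (hb : b = 0) mul0r; apply: homogz0.
Qed.

Lemma homogz_prod (T : Type) (s : seq T) (d : T -> int) (F : T -> A) :
  (forall x, homogz (d x) (F x)) ->
  homogz (\sum_(x <- s) d x) (\prod_(x <- s) F x).
Proof.
move=> hF; elim: s => [|x s IH]; first by rewrite !big_nil; apply: homog1.
by rewrite !big_cons; apply: homogzM.
Qed.

Definition elem_series (n : nat) : A := (-1) ^+ n * e n.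

(** For [e_ r] this is the sequence H_r, by [h_complete]. *)
Definition complete (n : int) : A :=
  if n is Posz m then fps_inv elem_series m else 0.

Lemma complete_neg n : n < 0 -> complete n = 0. Proof. by case: n. Qed.

Lemma complete0 : complete 0 = 1.
Proof. by rewrite /= fps_invE big_ord0 subr0. Qed.

Lemma elem_complete (n : int) : 0 < n ->
  \sum_(i < `|n|.+1) elem_series i * complete (n - i%:Z) = 0.
Proof.
case: n => // -[//|n] _; rewrite absz_nat.
have E0 : elem_series 0 = 1 by rewrite /elem_series e0 mulr1.
apply: etrans (fps_mulfV n.+1 E0); rewrite /fps_mul.
by apply: eq_bigr => i _; rewrite subzn ?leq_ord.
Qed.

Lemma homogz_complete n : homogz n (complete n).
Proof.
case: n => //= n; elim/ltn_ind: n => n IH; rewrite fps_invE.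
apply: homogD; first by case: n {IH} => [|n]; [apply: homog1|apply: homog0].
apply/homogN/homog_sum => i _; rewrite /elem_series -mulrA.
have hi : homog n (e (n - i) * fps_inv elem_series i).
  by rewrite -[n in homog n](subnK (ltnW (ltn_ord i))); apply/homogX/IH.
by rewrite -signr_odd mulr_sign; case: (odd _) => //; apply: homogN.
Qed.

Definition schur (k : nat) (la : seq nat) : A :=
  \det (\matrix_(i < k, j < k) complete ((nth 0%N la j)%:Z - j%:Z + i%:Z)).

(** In each Leibniz term the shifts i and -s(i) cancel in the sum over i, leaving the sum of the
    parts. *)
Lemma homog_schur k la : size la = k -> homog (sumn la) (schur k la).
Proof.
move=> sz_la; apply: homog_sum => s _.
suff hs : homog (sumn la)
    (\prod_(i < k) complete ((nth 0%N la (s i))%:Z - (s i)%:Z + i%:Z)).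
  under eq_bigr do rewrite mxE.
  by rewrite -signr_odd mulr_sign; case: (odd _) => //; apply: homogN.
have := @homogz_prod _ (index_enum 'I_k) _ _ (fun i : 'I_k =>
  homogz_complete ((nth 0%N la (s i))%:Z - (s i)%:Z + i%:Z)).
suff -> : \sum_(i < k) ((nth 0%N la (s i))%:Z - (s i)%:Z + i%:Z) = (sumn la)%:Z by [].
have re (F : 'I_k -> int) : \sum_i F (s i) = \sum_i F i.
  by rewrite [RHS](reindex_inj (@perm_inj _ s)).
rewrite big_split sumrB /= (re (fun j => (nth 0%N la j)%:Z)) (re (fun j => j%:Z)).
rewrite subrK; rewrite sumnE (big_nth 0%N) big_mkord sz_la.
by rewrite (big_morph Posz PoszD (erefl 0%:Z)).
Qed.

(** The last column has entries h_(i-k), which are 0 except for a final 1. *)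
Lemma schur_last0 k la : nth 0%N la k = 0%N -> schur k.+1 la = schur k la.
Proof.
move=> lak; rewrite /schur (expand_det_col _ ord_max) big_ord_recr /=.
rewrite big1 => [|a _]; last first.
  rewrite mxE /= lak complete_neg ?mul0r //.
  by have := ltn_ord a; lia.
rewrite mxE /= lak sub0r addNr complete0 mul1r add0r.
rewrite /cofactor /= -signr_odd oddD addbb mul1r.
congr (\det _); apply/matrixP => a b; rewrite !mxE /= /bump.
by rewrite !(leqNgt k) !ltn_ord.
Qed.

Lemma eq_schur k la mu :
  (forall j, (j < k)%N -> nth 0%N la j = nth 0%N mu j) -> schur k la = schur k mu.
Proof.
move=> eq_la; congr (\det _); apply/matrixP => i j.
by rewrite !mxE eq_la.
Qed.

Lemma elem_complete_rank (N : nat) (n : int) :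
  (forall i, (N < i)%N -> e i = 0) -> 0 < n ->
  \sum_(i < N.+1) elem_series i * complete (n - i%:Z) = 0.
Proof.
move=> eN n0; rewrite -[RHS](elem_complete n0).
(* Both sums extend to [M.+1] terms: those beyond N vanish because e_i = 0, those beyond |n| because
   h_(n-i) = 0. *)
pose F i := elem_series i * complete (n - i%:Z); pose M := (N + `|n|)%N.
have widen m : (forall i, (m < i)%N -> F i = 0) -> (m <= M)%N ->
    \sum_(i < m.+1) F i = \sum_(i < M.+1) F i.
  move=> Fm le_m; rewrite (big_ord_widen _ F (_ : m.+1 <= M.+1)%N) //.
  rewrite [RHS](bigID (fun i : 'I__ => (i < m.+1)%N)) /= [X in _ + X]big1 ?addr0 //.
  by move=> i; rewrite -leqNgt => /Fm.
transitivity (\sum_(i < M.+1) F i).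
  apply: widen => [i lt_i|]; last exact: leq_addr.
  by rewrite /F /elem_series eN // mulr0 mul0r.
apply/esym/widen => [i lt_i|]; last exact: leq_addl.
by rewrite /F complete_neg ?mulr0 //; lia.
Qed.

(* The columns of the Jacobi-Trudi matrix of [mu] are those of [la] shifted by one
   row, i.e. multiplied by the companion matrix [C] of the recurrence satisfied
   by the complete functions in finite rank. *)
Lemma schur_succ k la mu : (forall i, (k.+1 < i)%N -> e i = 0) ->
  (forall j, (j < k.+1)%N -> nth 0%N mu j = (nth 0%N la j).+1) ->
  schur k.+1 mu = e k.+1 * schur k.+1 la.
Proof.
move=> ek mu_la.
pose C : 'M[A]_k.+1 := \matrix_(i, l)
  if (i < k)%N then (l == i.+1 :> nat)%:R else (-1) ^+ (k - l) * e (k.+1 - l).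
have detC : \det C = e k.+1.
  (* Column 0 of [C] vanishes outside the last row. Deleting both leaves the identity, and the
     cofactor sign cancels the sign of the entry. *)
  rewrite (expand_det_col _ ord0) (bigD1 ord_max) //= big1 ?addr0.
    rewrite mxE /= ltnn subn0 /cofactor /= addn0.
    rewrite mulrCA -mulrA mulrA -expr2 sqrr_sign mul1r.
    set M := row' _ _; suff -> : M = 1%:M by rewrite det1 mulr1.
    apply/matrixP => i j; rewrite !mxE lift_max ltn_ord lift0 eqSS.
    by rewrite -(inj_eq val_inj) eq_sym.
  move=> i ne_i; rewrite mxE ifT ?mul0r // ltn_neqAle -ltnS ltn_ord andbT.
  by apply: contraNneq ne_i => eq_i; apply/eqP/val_inj.
rewrite -detC -det_mulmx; congr (\det _); apply/matrixP => i j.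
rewrite !mxE (mu_la j (ltn_ord j)); under eq_bigr do rewrite 2!mxE.
case: (ltnP i k) => [lt_ik|le_ki].
  rewrite (bigD1 (Ordinal (lt_ik : (i.+1 < k.+1)%N))) //= eqxx mul1r big1 ?addr0.
    by congr complete; lia.
  move=> l ne_l; rewrite (_ : (l == i.+1 :> nat) = false) ?mul0r //.
  by apply: contraNF ne_l => /eqP eq_l; apply/eqP/val_inj.
(* In the last row, the recurrence at index la_j + 1 - j + k, positive because j <= k, expresses the
   leading term through the k+1 preceding ones. *)
have {le_ki}eq_ik : i = k :> nat.
  by apply/eqP; rewrite eqn_leq -ltnS ltn_ord le_ki.
have n0 : 0 < (nth 0%N la j).+1%:Z - j%:Z + i%:Z :> int.
  by have := ltn_ord j; lia.
have := elem_complete_rank ek n0; rewrite big_ord_recl /= {1}/elem_series e0.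
rewrite expr0 !mul1r subr0 => /eqP; rewrite addr_eq0 => /eqP ->.
rewrite -sumrN (reindex_inj rev_ord_inj) /=; apply: eq_bigr => l _.
rewrite /bump /= add1n /elem_series -!mulNr.
have lt_l := ltn_ord l; congr (_ * _ * complete _); last lia.
  rewrite -[LHS]mulN1r -exprS; rewrite (_ : (k.+1 - l.+1).+2 = (k - l).+2)%N; last lia.
  by rewrite !exprS mulrA -expr2 sqrrN expr1n mul1r.
by congr e; lia.
Qed.
End Homogeneous.

Lemma nth_geq_sorted la i j : sorted geq la -> (i <= j)%N ->
  (nth 0%N la j <= nth 0%N la i)%N.
Proof.
move=> la_sorted le_ij; have [le_sz|lt_j] := leqP (size la) j.
  by rewrite nth_default.
have geq_trans : transitive geq by move=> a b c /= ? /leq_trans; apply.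
have geq_refl : reflexive geq by move=> a /=.
apply: (sorted_leq_nth geq_trans geq_refl 0%N la_sorted) => //.
by rewrite inE (leq_ltn_trans le_ij).
Qed.

(** * Truncation and lifting between ranks *)

Section Ranks.
Variables (K : nzRingType) (A : option nat -> comNzRingType).
Variables (iota : forall r, {rmorphism K -> A r}) (e : forall r, nat -> A r).
Variable phi : forall r p, {rmorphism A r -> A p}.
Hypothesis phi_iota : forall r p z, phi r p (iota r z) = iota p z.
Hypothesis e0 : forall r, e r 0 = 1.
Hypothesis e_gt : forall r i, ~~ le_rank i r -> e r i = 0.
Hypothesis e_inj : forall r i, le_rank i r -> injective (fun b => e r i * b).
(** The excluded case r < i <= p has e_i = 0 in rank r but not in rank p. Thus [phi] serves as
    truncation when p <= r and as lift when r <= p. *)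
Hypothesis phi_e : forall r p i, le_rank i r || ~~ le_rank i p ->
  phi r p (e r i) = e p i.

Section Truncation.
Variables r p : option nat.
Hypothesis le_pr : forall i, le_rank i p -> le_rank i r.

Lemma phi_trunc i : phi r p (e r i) = e p i.
Proof. by apply: phi_e; case: (boolP (le_rank i p)) => [/le_pr->|]; rewrite ?orbT. Qed.

Lemma homog_phi n b : homog (iota _) (e r) n b -> homog (iota _) (e p) n (phi r p b).
Proof.
elim=> {n b} [n||i n b _ IH|n z b c _ IHb _ IHc].
- by rewrite rmorph0; apply: homog0.
- by rewrite rmorph1; apply: homog1.
- by rewrite rmorphM /= phi_trunc; apply: homogX.
- by rewrite rmorphD !rmorphM /= !phi_iota; apply: homogZD.
Qed.

Lemma phi_complete n : phi r p (complete (e r) n) = complete (e p) n.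
Proof.
case: n => [n|n]; last by rewrite /= rmorph0.
elim/ltn_ind: n => n IH /=; rewrite !fps_invE rmorphB rmorph_nat rmorph_sum /=.
congr (_ - _); apply: eq_bigr => i _; rewrite rmorphM /= [phi _ _ (fps_inv _ _)]IH //.
by rewrite /elem_series rmorphM rmorphXn rmorphN1 /= phi_trunc.
Qed.

Lemma phi_schur k la : phi r p (schur (e r) k la) = schur (e p) k la.
Proof.
rewrite /schur -det_map_mx; congr (\det _); apply/matrixP => i j.
by rewrite !mxE /= phi_complete.
Qed.
End Truncation.

(** Going down to rank p and back sets e_(p+1) = 0 inside rank p+1, so what is lost is a multiple of
    e_(p+1). *)
Lemma phi_SomeSK p n b : homog (iota _) (e (Some p.+1)) n b ->
  exists2 q, homogz (iota _) (e (Some p.+1)) (n%:Z - p.+1%:Z) q &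
    b = e (Some p.+1) p.+1 * q + phi (Some p) (Some p.+1) (phi (Some p.+1) (Some p) b).
Proof.
elim=> {n b} [n||i n b hb [q hq Eb]|n z b c hb [q hq Eb] hc [q' hq' Ec]].
- by exists 0; [apply: homogz0 | rewrite !rmorph0 mulr0 addr0].
- by exists 0; [apply: homogz0 | rewrite !rmorph1 mulr0 add0r].
- have [eq_i|ne_i] := eqVneq i p.+1.
    (* Truncation kills e_(p+1), so the whole cofactor [b] is the quotient. *)
    exists b.
      by rewrite (_ : (i + n)%N%:Z - p.+1%:Z = n%:Z) //; lia.
    rewrite !rmorphM /= phi_trunc => [|j /= /leq_trans]; last by apply.
    have e_i : e (Some p) i = 0 by apply: e_gt; rewrite eq_i /= ltnn.
    by rewrite e_i rmorph0 mul0r addr0 eq_i.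
  exists (e (Some p.+1) i * q).
    rewrite (_ : (i + n)%N%:Z - p.+1%:Z = i%:Z + (n%:Z - p.+1%:Z)); last by lia.
    apply: homogzM hq.
    by have := homogX i (@homog1 _ _ (iota _) (e (Some p.+1))); rewrite addn0 mulr1.
  rewrite {1}Eb mulrDr mulrCA !rmorphM /=; congr (_ + _ * _).
  rewrite phi_trunc => [|j /= /leq_trans]; last by apply.
  by rewrite phi_e //=; lia.
- exists (iota _ z * q + q'); first exact: homogzZD.
  by rewrite {1}Eb {1}Ec !rmorphD !rmorphM /= !phi_iota mulrDr mulrCA mulrDr addrACA.
Qed.

(** Weight n involves only e_1, ..., e_n, all of which survive in rank m >= n. *)
Lemma phi_NoneK m n b : homog (iota _) (e None) n b -> (n <= m)%N ->
  phi (Some m) None (phi None (Some m) b) = b.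
Proof.
elim=> {n b} [n||i n b _ IH|n z b c _ IHb _ IHc] le_nm.
- by rewrite !rmorph0.
- by rewrite !rmorph1.
- rewrite !rmorphM /= IH; last by lia.
  by rewrite !phi_e //=; lia.
- by rewrite !rmorphD !rmorphM /= !phi_iota IHb // IHc.
Qed.

(** * Spanning by Schur elements, indexed by lists of exactly k parts, zeros allowed *)

Inductive schur_span r (k n : nat) : A r -> Prop :=
| schur_span0 : schur_span k n 0
| schur_spanZD z la b :
    size la = k -> sorted geq la -> sumn la = n ->
    schur_span k n b -> schur_span k n (iota r z * schur (e r) k la + b).

Lemma schur_spanD r k n (b c : A r) :
  schur_span k n b -> schur_span k n c -> schur_span k n (b + c).
Proof.
move=> hb hc; elim: hb => [|z la {}b sz_la la_sorted sum_la _ IH].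
  by rewrite add0r.
by rewrite -addrA; apply: schur_spanZD.
Qed.

Lemma schur_span_mulSome k n b : schur_span k.+1 n b ->
  schur_span k.+1 (n + k.+1) (e (Some k.+1) k.+1 * b).
Proof.
elim=> [|z la {}b sz_la la_sorted sum_la _ IH].
  by rewrite mulr0; apply: schur_span0.
rewrite mulrDr mulrCA -(@schur_succ _ _ _ k la (map succn la)) => //.
- apply: schur_spanZD => //; first by rewrite size_map.
    by rewrite sorted_map.
  by rewrite -sum_la -sz_la; elim: (la) => //= x s ->; lia.
- by move=> i lt_i; apply: e_gt; rewrite /= -ltnNge.
by move=> j lt_j; rewrite (nth_map 0%N) ?sz_la.
Qed.

(** Appending a zero part gives a Schur element of rank p+1 that truncates to the given one; by
    [phi_SomeSK] it differs from the lift by a multiple of e_(p+1). *)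
Lemma schur_span_liftSome p n c : schur_span p n c ->
  exists q d, [/\ homogz (iota _) (e (Some p.+1)) (n%:Z - p.+1%:Z) q, schur_span p.+1 n d &
    phi (Some p) (Some p.+1) c = e (Some p.+1) p.+1 * q + d].
Proof.
elim=> [|z la {}c sz_la la_sorted sum_la _ [q [d [hq hd Ec]]]].
  exists 0, 0; split; [exact: homogz0|exact: schur_span0|].
  by rewrite rmorph0 mulr0 addr0.
have sz_la0 : size (rcons la 0%N) = p.+1 by rewrite size_rcons sz_la.
have sum_la0 : sumn (rcons la 0%N) = n by rewrite sumn_rcons addn0.
have eq_la0 r : schur (e r) p.+1 (rcons la 0%N) = schur (e r) p la.
  rewrite schur_last0 ?nth_rcons ?sz_la ?ltnn ?eqxx //.
  by apply: eq_schur => j lt_j; rewrite nth_rcons sz_la lt_j.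
have := homog_schur (iota _) (e (Some p.+1)) sz_la0; rewrite sum_la0.
case/phi_SomeSK=> q' hq'; rewrite phi_schur => [|j /= /leq_trans]; last by apply.
rewrite (eq_la0 (Some p)) => Ela.
exists (iota _ (- z) * q' + q).
exists (iota _ z * schur (e (Some p.+1)) p.+1 (rcons la 0%N) + d); split.
- exact: homogzZD.
- apply: schur_spanZD => //.
  by case: (la) la_sorted => //= x s; rewrite rcons_path => ->.
- by rewrite rmorphD rmorphM /= phi_iota Ec Ela rmorphN; ring.
Qed.

Lemma homog_rank0 n b : homog (iota _) (e (Some 0%N)) n b ->
  exists2 z, b = iota _ z & (0 < n)%N -> z = 0.
Proof.
elim=> {n b} [n||i n b hb [z -> z0]|n z b c _ [y -> y0] _ [x -> x0]].
- by exists 0; rewrite ?rmorph0.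
- by exists 1; rewrite ?rmorph1.
- case: i => [|i]; first by exists z; rewrite // e0 mul1r.
  by exists 0; rewrite // e_gt // mul0r rmorph0.
- exists (z * y + x); first by rewrite rmorphD rmorphM.
  by move=> n0; rewrite y0 // x0 // mulr0 addr0.
Qed.

Lemma schur_span_Some p n b : homog (iota _) (e (Some p)) n b -> schur_span p n b.
Proof.
elim: p n b => [|p IHp] n b.
  case/homog_rank0=> z -> z0; have [n0|n0] := posnP n; last first.
    by rewrite z0 // rmorph0; apply: schur_span0.
  have schur0 : schur (e (Some 0%N)) 0 [::] = 1 by rewrite /schur det_mx00.
  rewrite -[iota _ z]mulr1 -schur0 -[_ * _]addr0.
  by apply: (@schur_spanZD _ _ _ z [::]); rewrite ?n0 //; apply: schur_span0.
(* Lifting the truncation of [b] gives b = e_(p+1) (q + q') + d with [d] in the span. Here q + q'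
   has weight n - (p+1): it is 0 for n <= p, and otherwise induction on n applies. *)
elim/ltn_ind: n b => n IHn b hb; have [q hq Eb] := phi_SomeSK hb.
have hc : homog (iota _) (e (Some p)) n (phi (Some p.+1) (Some p) b).
  by apply: homog_phi hb => j /= /leq_trans; apply.
have [q' [d [hq' hd Ec]]] := schur_span_liftSome (IHp _ _ hc).
rewrite Eb Ec addrA -mulrDr; apply: schur_spanD hd.
have := homogzZD 1 hq hq'; rewrite rmorph1 mul1r.
have [lt_np|le_pn] := ltnP n p.+1.
  have -> : n%:Z - p.+1%:Z = Negz (p - n) by lia.
  by move=> /= ->; rewrite mulr0; apply: schur_span0.
rewrite subzn // => hqq'; rewrite -(subnK le_pn).
by apply/schur_span_mulSome/IHn => //; lia.
Qed.

Lemma schur_span_None n b : homog (iota _) (e None) n b -> schur_span n n b.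
Proof.
move=> hb; rewrite -(phi_NoneK hb (leqnn n)).
have /schur_span_Some := homog_phi (r := None) (p := Some n) (fun _ _ => isT) hb.
elim=> [|z la {hb}b sz_la la_sorted sum_la _ IH].
  by rewrite rmorph0; apply: schur_span0.
have := homog_schur (iota _) (e None) sz_la; rewrite sum_la => hla.
rewrite rmorphD rmorphM /= phi_iota -(phi_schur (r := None)) // (phi_NoneK hla) //.
exact: schur_spanZD.
Qed.

(** * Linear independence of the Schur elements *)

Lemma schur_free_Some p (T : eqType) (s : seq T) (f : T -> seq nat) (c : T -> K) :
    injective (iota (Some 0%N)) ->
    uniq s -> {in s &, injective f} ->
    {in s, forall t, size (f t) = p /\ sorted geq (f t)} ->
    \sum_(t <- s) iota _ (c t) * schur (e (Some p)) p (f t) = 0 ->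
  {in s, forall t, c t = 0}.
Proof.
(* Outer induction on the rank, inner induction on a strict bound [N] for the last parts.
   Coefficients stay attached to the index [t] while [f] changes. *)
move=> iota_inj; elim: p s f => [|p IHp] s f s_uniq f_inj f_part.
  case: s => [|t [|t' s]] // in s_uniq f_inj f_part *; last first.
    have [/size0nil ft _] := f_part t (mem_head _ _).
    have t's : t' \in [:: t, t' & s] by rewrite !inE eqxx orbT.
    have [/size0nil ft' _] := f_part t' t's.
    have /eqP := f_inj _ _ (mem_head _ _) t's (etrans ft (esym ft')).
    by move: s_uniq; rewrite /= inE; case: eqP.
  rewrite big_seq1 /schur det_mx00 mulr1 => c0 _ /[1!inE] /eqP->.
  by apply: iota_inj; rewrite c0 rmorph0.
have [N ltN] : exists N, {in s, forall t, (nth 0%N (f t) p < N)%N}.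
  exists (\max_(t <- s) nth 0%N (f t) p).+1 => t ts.
  by rewrite ltnS; apply: (@leq_bigmax_seq _ _ _ (fun t => nth 0%N (f t) p)).
elim: N s f s_uniq f_inj f_part ltN => [|N IHN] s f s_uniq f_inj f_part ltN.
  by move=> _ t /ltN.
(* Terms with last part 0 survive e_(p+1) = 0; all others are divisible by e_(p+1). *)
pose a t := nth 0%N (f t) p == 0%N.
have schurS t : t \in s -> ~~ a t ->
    schur (e (Some p.+1)) p.+1 (f t) =
    e (Some p.+1) p.+1 * schur (e (Some p.+1)) p.+1 (map predn (f t)).
  move=> ts at0; have [sz_ft ft_sorted] := f_part t ts.
  apply: schur_succ => // [i lt_i|j lt_j].
    by apply: e_gt; rewrite /= -ltnNge.
  rewrite (nth_map 0%N) ?sz_ft // prednK //.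
  by apply: leq_trans (nth_geq_sorted ft_sorted (lt_j : (j <= p)%N)); rewrite lt0n.
rewrite (bigID a) /= => sum0.
have c0a : {in s, forall t, a t -> c t = 0}.
  move=> t ts at0.
  have ta : t \in [seq t <- s | a t] by rewrite mem_filter at0.
  apply: (IHp [seq t <- s | a t] (fun t => take p (f t))) (ta).
  - exact: filter_uniq.
  - move=> t1 t2; rewrite !mem_filter => /andP[/eqP a1 s1] /andP[/eqP a2 s2] eq_f.
    have [[sz1 _] [sz2 _]] := (f_part _ s1, f_part _ s2).
    apply: f_inj => //; rewrite -(take_size (f t1)) -(take_size (f t2)) sz1 sz2.
    by rewrite !(take_nth 0%N) ?sz1 ?sz2 // a1 a2 eq_f.
  - move=> t1; rewrite mem_filter => /andP[_ /f_part [sz1 sorted1]].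
    by rewrite size_takel ?sz1 ?take_sorted.
  (* Truncation to rank p leaves exactly the terms selected by [a], with the final zero removed. *)
  have := congr1 (phi (Some p.+1) (Some p)) sum0.
  rewrite rmorphD !rmorph_sum rmorph0 [X in _ + X]big_seq_cond.
  rewrite [X in _ + X]big1 ?addr0 => [sum0'|t1 /andP[s1 a1]].
    rewrite -[RHS]sum0' big_filter; apply: eq_bigr => t1 /eqP a1.
    rewrite rmorphM /= phi_iota phi_schur => [|j /= /leq_trans]; last by apply.
    rewrite schur_last0 //; congr (_ * _); apply: eq_schur => j lt_j.
    by rewrite nth_take.
  rewrite rmorphM /= schurS // rmorphM /= phi_trunc => [|j /= /leq_trans]; last by apply.
  by rewrite (@e_gt (Some p)) /= ?ltnn // mul0r mulr0.
move: sum0; rewrite big_seq_cond big1 ?add0r => [|t /andP[ts at0]]; last first.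
  by rewrite c0a // rmorph0 mul0r.
move=> sum0 t ts; have [|at0] := boolP (a t); first exact: c0a.
have ta : t \in [seq t <- s | ~~ a t] by rewrite mem_filter at0.
have pos t1 : t1 \in [seq t <- s | ~~ a t] ->
    map succn (map predn (f t1)) = f t1.
  rewrite mem_filter => /andP[a1 s1]; have [sz1 sorted1] := f_part t1 s1.
  rewrite -map_comp map_id_in // => x /(nthP 0%N) [j lt_j <-] /=.
  rewrite prednK //; rewrite sz1 in lt_j.
  by apply: leq_trans (nth_geq_sorted sorted1 (lt_j : (j <= p)%N)); rewrite lt0n.
apply: (IHN [seq t <- s | ~~ a t] (fun t => map predn (f t))) (ta).
- exact: filter_uniq.
- move=> t1 t2 s1 s2 eq_f; apply: f_inj.
  + by move: s1; rewrite mem_filter => /andP[].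
  + by move: s2; rewrite mem_filter => /andP[].
  by rewrite -(pos t1) // -(pos t2) // eq_f.
- move=> t1 s1; have /f_part [sz1 sorted1]: t1 \in s by move: s1; rewrite mem_filter => /andP[].
  split; first by rewrite size_map.
  rewrite sorted_map; apply: sub_sorted sorted1 => x y /=.
  by rewrite /relpre /=; lia.
- move=> t1 s1; have s1' : t1 \in s by move: s1; rewrite mem_filter => /andP[].
  have := ltN _ s1'; rewrite -{1}(pos _ s1) (nth_map 0%N) //.
  by rewrite size_map (f_part _ s1').1.
(* The remaining relation is e_(p+1) times one whose parts are all smaller by 1; cancelling e_(p+1)
   brings the bound down to [N]. *)
apply: (@e_inj (Some p.+1) p.+1); first exact: leqnn.
rewrite mulr0 -[RHS]sum0 mulr_sumr big_filter -big_filter -[RHS]big_filter.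
apply: eq_big_seq => t1; rewrite mem_filter => /andP[a1 s1].
by rewrite mulrCA -schurS.
Qed.

(** A relation between lists of p parts truncates to the same relation in rank p. *)
Lemma schur_free_None p (T : eqType) (s : seq T) (f : T -> seq nat) (c : T -> K) :
    injective (iota (Some 0%N)) ->
    uniq s -> {in s &, injective f} ->
    {in s, forall t, size (f t) = p /\ sorted geq (f t)} ->
    \sum_(t <- s) iota _ (c t) * schur (e None) p (f t) = 0 ->
  {in s, forall t, c t = 0}.
Proof.
move=> iota_inj s_uniq f_inj f_part sum0.
apply: (schur_free_Some iota_inj s_uniq f_inj f_part).
rewrite -[RHS](rmorph0 (phi None (Some p))) -[X in phi _ _ X]sum0 rmorph_sum; apply: eq_bigr => t _.
by rewrite rmorphM /= phi_iota phi_schur.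
Qed.
End Ranks.

(** * The rings B_r as an instance of the abstract family *)

Lemma malgU_scale (M : choiceType) (R : nzRingType) (z : R) (m : M) :
  << z *g m >> = z *: << m >>.
Proof. by apply/malgP => k; rewrite mcoeffZ !mcoeffU mulrnAr mulr1. Qed.

Section BringRank.
Variable r : option nat.
Implicit Types b c : Bring r.

Lemma e_ucm (x : varidx r) : e_ r (val x) = << ucm x >>.
Proof.
rewrite /e_; case Ex: (val x) => [|i]; last by rewrite -Ex valK.
by exfalso; have := valP x; rewrite Ex.
Qed.

Lemma e_gt_rank i : ~~ le_rank i r -> e_ r i = 0.
Proof.
case: i => [|i] gtir; first by case: (r) gtir.
by rewrite /e_ insubF //=; apply: negbTE.
Qed.

Lemma e_mul_inj i : le_rank i r -> injective (fun b => e_ r i * b).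
Proof.
case: i => [|i] leir; first by move=> b c; rewrite !mul1r.
have xP : (0 < i.+1)%N && le_rank i.+1 r by [].
by rewrite (e_ucm (Sub i.+1 xP)); apply: mulU_inj.
Qed.

Definition Bring_alg : {rmorphism rat -> Bring r} := in_alg (Bring r).

Lemma Bring_algE z b : Bring_alg z * b = z *: b.
Proof. exact: mulr_algl. Qed.

Lemma Bring_alg_inj : injective Bring_alg.
Proof. exact: fmorph_inj. Qed.

(** Monomials are homogeneous and span B_r. *)
Lemma Bring_homog_ind (P : Bring r -> Prop) :
  P 0 -> (forall (a : rat) b c, P b -> P c -> P (a *: b + c)) ->
  (forall n b, homog Bring_alg (e_ r) n b -> P b) -> forall b, P b.
Proof.
move=> P0 PZD Phom b; rewrite (monalgE b).
elim: (X in \sum_(k <- X) _) => [|m s IH]; first by rewrite big_nil.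
rewrite big_cons malgU_scale; apply: PZD => //; suff [n /Phom//] : exists n, homog Bring_alg (e_ r) n << m >>.
elim/cmonom_rect_ucm: m {IH} => [|x m [n hn]]; first by exists 0%N; apply: homog1.
exists (val x + n)%N; have -> : << mmul (ucm x) m >> = e_ r (val x) * << m >>.
  by rewrite e_ucm malgM_def fgmulUU mulr1.
exact: homogX.
Qed.

Lemma h_complete n : h_ r n = complete (e_ r) n.
Proof. by case: n. Qed.
End BringRank.

(** The algebra morphism sending the indeterminate e_i to the e_i of rank p, which is 0 when i >
    p. *)
Definition Bring_map r p : {rmorphism Bring r -> Bring p} :=
  mmap (Bring_alg p) (cmonom_eval (fun x : varidx r => e_ p (val x))).

Lemma Bring_map_alg r p z : Bring_map r p (Bring_alg r z) = Bring_alg p z.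
Proof.
by rewrite -[Bring_alg r z]mulr1 Bring_algE /Bring_map /= mmapZ mmap1 mulr1.
Qed.

Lemma Bring_map_e r p i : le_rank i r || ~~ le_rank i p ->
  Bring_map r p (e_ r i) = e_ p i.
Proof.
case: i => [|i] leir; first exact: rmorph1.
case: (boolP (le_rank i.+1 r)) leir => [leir _|gtir gtip].
  have xP : (0 < i.+1)%N && le_rank i.+1 r by [].
  rewrite (e_ucm (Sub i.+1 xP)) [LHS]mmapU /= cmonom_evalU /=.
  by rewrite [X in X * _]scale1r mul1r.
by rewrite (e_gt_rank gtir) (e_gt_rank gtip) rmorph0.
Qed.

(** * The bracket of a monomial as a Jacobi-Trudi determinant *)

Section Bracket.
Variable r : option nat.

Lemma U_u a j :
  U_ a (u_ r j) = \sum_(c < a.+1) Eser r (a - c) * h_ r (j + c%:Z).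
Proof.
have cE n : egf_coef (u_ r j) n = h_ r (n%:Z + j).
  rewrite /egf_coef /u_ scalerA mulfV ?scale1r; first reflexivity.
  by rewrite pnatr_eq0 -lt0n fact_gt0.
rewrite U_E [RHS](reindex_inj rev_ord_inj); apply: eq_bigr => i _; rewrite cE.
have le_i := leq_ord i.
have -> : (a - rev_ord i)%N = i by rewrite /=; lia.
have -> : (a - i)%N%:Z + j = j + (rev_ord i)%:Z by rewrite /=; lia.
reflexivity.
Qed.

Lemma bracket_schur (la : partr r) k : (size (val la) <= k)%N ->
  bracket_mono r (part_mono la) = schur (e_ r) k (val la).
Proof.
move=> le_k; rewrite (@bracket_monoE _ _ k) => [|j le_kj]; last first.
  by rewrite /= /part_idx /part_nth nth_default ?sub0r // (leq_trans le_k).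
(* By [U_u] the bracket matrix is [L], lower unitriangular with entries the coefficients of E_r(t),
   times the Jacobi-Trudi matrix. *)
pose L : 'M[Bring r]_k := \matrix_(a, c) if (c <= a)%N then Eser r (a - c) else 0.
have detL : \det L = 1.
  rewrite det_trig; first by apply: big1 => i _; rewrite mxE leqnn subnn; apply: mulr1.
  by apply/is_trig_mxP => i j lt_ij; rewrite mxE leqNgt lt_ij.
rewrite -[RHS]mul1r -detL -det_mulmx; congr (\det _); apply/matrixP => a b.
rewrite !mxE U_u; pose F (c : nat) := Eser r (a - c) * h_ r (part_mono la b + c%:Z).
transitivity (\sum_(c < k | (c < a.+1)%N) F c).
  exact: (big_ord_widen k F (ltn_ord a)).
rewrite [LHS]big_mkcond; apply: eq_bigr => c _.
rewrite ltnS [L a c]mxE mxE -h_complete.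
case: (c <= a)%N; first reflexivity.
by rewrite mul0r.
Qed.
End Bracket.

(** * Partitions without zeros versus lists padded to a fixed length *)

Section Padding.
Implicit Types la mu : seq nat.

Lemma nth_filter_nonzero la j : sorted geq la ->
  nth 0%N [seq x <- la | x != 0%N] j = nth 0%N la j.
Proof.
elim: la j => // x la IH j la_sorted /=.
have la0 i := nth_geq_sorted la_sorted (leq0n i).
case: eqVneq la0 => [->|_] la0 /=; last first.
  by case: j => //= j; apply/IH/path_sorted/la_sorted.
rewrite IH; last exact: path_sorted la_sorted.
have := la0 j.+1; have := la0 j; rewrite /= !leqn0.
by move=> /eqP-> /eqP->.
Qed.

Definition pad (k : nat) la := la ++ nseq (k - size la) 0%N.

Lemma size_pad k la : (size la <= k)%N -> size (pad k la) = k.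
Proof. by move=> le_k; rewrite size_cat size_nseq subnKC. Qed.

Lemma nth_pad k la j : nth 0%N (pad k la) j = nth 0%N la j.
Proof.
rewrite nth_cat; case: ltnP => // le_j.
by rewrite nth_nseq if_same nth_default.
Qed.

Lemma sorted_pad k la : sorted geq la -> sorted geq (pad k la).
Proof.
have zeros x m : path geq x (nseq m 0%N) by elim: m x => //= m IH x; rewrite IH.
rewrite /pad; case: la => [|x la] /=; first by case: (k - 0)%N => //= m; apply: zeros.
by rewrite cat_path => ->; apply: zeros.
Qed.

Lemma pad_inj k la mu : 0%N \notin la -> 0%N \notin mu ->
  pad k la = pad k mu -> la = mu.
Proof.
have unpad nu : 0%N \notin nu -> [seq x <- pad k nu | x != 0%N] = nu.
  move=> nu0; rewrite filter_cat filter_nseq cats0.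
  by apply/all_filterP/allP => x xnu; apply: contraNneq nu0 => <-.
by move=> /unpad {2}<- /unpad {2}<- ->.
Qed.
End Padding.

(** * Bijectivity of the bracket *)

Section Bijection.
Variable r : option nat.

Lemma is_part_filter la : sorted geq la -> le_rank (size la) r ->
  is_part r [seq x <- la | x != 0%N].
Proof.
move=> la_sorted le_sz; apply/and3P; split.
- apply: sorted_filter la_sorted => a b c /= ? /leq_trans; exact.
- by rewrite mem_filter eqxx.
- case: (r) le_sz => //= n; apply: leq_trans.
  by rewrite size_filter count_size.
Qed.

Lemma schur_bracket la : sorted geq la -> le_rank (size la) r ->
  exists mu : partr r, bracket (Phi mu) = schur (e_ r) (size la) la.
Proof.
move=> la_sorted le_sz; exists (Sub _ (is_part_filter la_sorted le_sz)).
rewrite bracket_Phi (@bracket_schur _ _ (size la)).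
  by apply: eq_schur => j _; rewrite SubK nth_filter_nonzero.
by rewrite SubK size_filter count_size.
Qed.

Lemma homog_schur_span n b : homog (Bring_alg r) (e_ r) n b ->
  exists2 k, le_rank k r & schur_span Bring_alg e_ k n b.
Proof.
have e0 p : e_ p 0 = 1 by [].
case: r b => [p|] b hb.
  exists p; first exact: leqnn.
  exact: (schur_span_Some Bring_map_alg e0 e_gt_rank Bring_map_e).
exists n => //.
exact: (schur_span_None Bring_map_alg e0 e_gt_rank Bring_map_e).
Qed.

Lemma bracket_surj b : exists v : Fock r, bracket v = b.
Proof.
elim/Bring_homog_ind: b => [|z _ _ [v <-] [w <-]|n b].
- by exists 0; apply: raddf0.
- by exists (z *: v + w); rewrite linearP.
case/homog_schur_span=> k le_k; elim=> [|z la {}b sz_la la_sorted _ _ [w Ew]].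
  by exists 0; apply: raddf0.
rewrite -sz_la in le_k *; have [mu Emu] := schur_bracket la_sorted le_k.
by exists (z *: Phi mu + w); rewrite linearP /= Emu Ew Bring_algE.
Qed.

Lemma schur_free k (T : eqType) (s : seq T) (f : T -> seq nat) (c : T -> rat) :
    k = odflt k r -> uniq s -> {in s &, injective f} ->
    {in s, forall t, size (f t) = k /\ sorted geq (f t)} ->
    \sum_(t <- s) Bring_alg r (c t) * schur (e_ r) k (f t) = 0 ->
  {in s, forall t, c t = 0}.
Proof.
have e0 p : e_ p 0 = 1 by [].
case: r => [p /= ->|_].
  apply: (schur_free_Some Bring_map_alg e0 e_gt_rank (@e_mul_inj) Bring_map_e).
  exact: Bring_alg_inj.
apply: (schur_free_None Bring_map_alg e0 e_gt_rank (@e_mul_inj) Bring_map_e).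
exact: Bring_alg_inj.
Qed.

Lemma bracket_inj : injective (@bracket r).
Proof.
apply: raddf_inj => v v0; pose s := msupp (val v).
(* Each monomial of the support gets its partition; off the support the condition is void and any
   partition will do. *)
have fockP m : {la : partr r | m \in s -> m = part_mono la}.
  apply: cid; have [ms|] := boolP (m \in s); last by exists (part0 r).
  have /fock_predP/(_ m) := fock_valP v.
  by rewrite mcoeff_neq0 => /(_ ms) [la ->]; exists la.
pose g m : seq nat := val (sval (fockP m)).
(* A common number of parts: the rank if finite, else the greatest length over the support. *)
pose k := if r is Some n then n else (\max_(m <- s) size (g m))%N.
have sz_rank m : le_rank (size (g m)) r by have /and3P[] := valP (sval (fockP m)).
have le_k : {in s, forall m, (size (g m) <= k)%N}.
  move=> m ms; rewrite /k; have := sz_rank m; case: (r) => // _.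
  exact: (@leq_bigmax_seq _ _ _ (fun m => size (g m))).
have k_rank : k = odflt k r by rewrite /k; case: (r).
have g0 m : 0%N \notin g m by have /and3P[] := valP (sval (fockP m)).
have f_inj : {in s &, injective (fun m => pad k (g m))}.
  move=> m1 m2 s1 s2 /(pad_inj (g0 _) (g0 _))/val_inj eq_g.
  by rewrite (svalP (fockP m1) s1) (svalP (fockP m2) s2) eq_g.
have f_part : {in s, forall m, size (pad k (g m)) = k /\ sorted geq (pad k (g m))}.
  move=> m ms; split; first exact/size_pad/le_k.
  by apply: sorted_pad; have /and3P[] := valP (sval (fockP m)).
have c0 := schur_free (c := fun m => (val v)@_m) k_rank (fset_uniq s) f_inj f_part.
apply/val_inj/malgP => m; rewrite mcoeff0.
have [ms|] := boolP (m \in s); last by move/mcoeff_outdom.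
apply: c0 ms; rewrite -[RHS]v0; apply: eq_big_seq => m' ms'.
rewrite Bring_algE; suff -> : bracket_mono r m' = schur (e_ r) k (pad k (g m')) by [].
rewrite {1}(svalP (fockP m') ms') (bracket_schur (le_k _ ms')).
by apply: eq_schur => j _; rewrite nth_pad.
Qed.

Lemma bracket_bij : bijective (@bracket r).
Proof.
pose g b := sval (cid (bracket_surj b)).
have gK : cancel g (@bracket r) by move=> b; exact: svalP (cid (bracket_surj b)).
by exists g => // v; apply: bracket_inj; rewrite gK.
Qed.
End Bijection.

Theorem proposition5p3 (r : option nat) (hr : r <> Some 0%N) :
  exists bij : bijective (@bracket r : {linear Fock r -> Bring r}),
    let F : lmodType (Bring r) := transported bij in
    [/\ bracket (Phi0 r) = 1,
        bijective (fun b : Bring r => b *: (Phi0 r : F))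
      & forall (la : partr r) (k : nat),
          (if r is Some n then k = n else (size (val la) <= k)%N) ->
          (Phi la : F) = Delta k la *: (Phi0 r : F)].
Proof.
exists (bracket_bij r); move=> F.
have b1 : bracket (Phi0 r) = 1.
  by rewrite /Phi0 bracket_Phi (@bracket_schur _ _ 0) // /schur det_mx00.
(* The transported action multiplies brackets and Phi_0 has bracket 1. Hence the bracket inverts b
   |-> b Phi_0, and the last identity can be checked on brackets. *)
have bZ b : bracket (b *: (Phi0 r : F) : F) = b.
  apply: etrans (transport_scaleE (bracket_bij r) b (Phi0 r)) _.
  by rewrite /= b1 mulr1.
split => // [|la k hk].
  exists (@bracket r : F -> Bring r) => // v.
  by apply: bracket_inj; rewrite bZ.
apply: bracket_inj; rewrite bZ bracket_Phi (@bracket_schur _ _ k).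
  congr (\det _); apply/matrixP => i j; rewrite !mxE h_complete; reflexivity.
(* There must be at least as many rows as parts: for finite r by membership in P_r, for infinite r
   by the assumption on [k]. *)
have : le_rank (size (val la)) r by case/and3P: (valP la).
by move: (size _) hk => m; case: (r) => // n ->.
Qed.
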